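(* Let $n\ge 1$. Let $\mathcal{H}_n$ be the set of all halved alternating sign matrices $A=(a_{ij})_{1\le i\le n,\,1\le j\le 2n}$ of order $2n$ whose height matrix $h=(h_{ij})_{0\le i\le n,\,0\le j\le 2n}$ satisfies the boundary condition $h_{n,2i}=n$ for all $0\le i\le n$. For $A\in\mathcal{H}_n$ let $N_{-}(A,\mathrm{even})$ be the number of pairs $(i,j)$ with $i+j$ even and $a_{ij}=-1$, and let $N_{+}(A,\mathrm{odd})$ be the number of pairs $(i,j)$ with $i+j$ odd and $a_{ij}=1$. Then $$\sum_{A\in\mathcal{H}_n}2^{N_{-}(A,\mathrm{even})+N_{+}(A,\mathrm{odd})}=3^n\,5^{\binom n2}.$$
   Context: A halved alternating sign matrix of order $2n$ is an $n\times 2n$ matrix $A=(a_{ij})_{1\le i\le n,\,1\le j\le 2n}$ with entries in $\{0,1,-1\}$ such that: in each row and in each column the non-zero entries alternate in sign; each row sum equals $1$; and in each column the first (topmost) non-zero entry, if there is any, equals $1$. The height matrix of $A$ is the $(n+1)\times(2n+1)$ matrix $h$ with $h_{ij}=i+j-2\sum_{l=1}^{i}\sum_{r=1}^{j}a_{lr}$ for $0\le i\le n$, $0\le j\le 2n$ (empty sums are $0$). Its top row is automatically $(0,1,\dots,2n)$, its left column is $(0,1,\dots,n)$, its right column is $(2n,2n-1,\dots,n)$ (top to bottom), and adjacent entries differ by one. The boundary condition in the claim says that the bottom row of $h$ has the form $(n,c_1,n,c_2,n,\dots,n,c_n,n)$, where $c_i=h_{n,2i-1}$ for $1\le i\le n$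 is otherwise unrestricted (so each $c_i$ is $n-1$ or $n+1$). *)

(* Defs.v *)
From mathcomp Require Import all_boot all_order all_algebra.

Set Implicit Arguments.
Unset Strict Implicit.
Unset Printing Implicit Defensive.

Import Order.TTheory GRing.Theory Num.Theory.

Local Open Scope ring_scope.

(* Indices of matrices of entries start at 0, so 'M i j' is the entry          *)
(* a_(i+1)(j+1) of the 1-based convention. The parity of the sum of the two    *)
(* indices is the same in both conventions. The indices of the height matrix   *)
(* start at 0 in both conventions.                                             *)

Definition asm_values : seq int := [:: 0; 1; -1].

Definition nonzeros (s : seq int) : seq int := [seq x <- s | x != 0].

Definition alternating (s : seq int) : bool :=
  sorted (fun x y => x * y < 0) (nonzeros s).

Definition row_seq (m p : nat) (M : 'M[int]_(m, p)) (i : 'I_m) : seq int :=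
  [seq M i j | j <- enum 'I_p].

Definition col_seq (m p : nat) (M : 'M[int]_(m, p)) (j : 'I_p) : seq int :=
  [seq M i j | i <- enum 'I_m].

(* The default value 1 of 'head' makes the last condition hold for a zero      *)
(* column.                                                                     *)
Definition halved_asm (n : nat) (M : 'M[int]_(n, 2 * n)) : bool :=
  [&& [forall i, forall j, M i j \in asm_values],
      [forall i, alternating (row_seq M i)],
      [forall j, alternating (col_seq M j)],
      [forall i, \sum_j M i j == 1]
    & [forall j, head 1 (nonzeros (col_seq M j)) == 1]].

Definition height (n : nat) (M : 'M[int]_(n, 2 * n)) :
    'M[int]_(n.+1, (2 * n).+1) :=
  \matrix_(i, j) ((i + j)%N%:Z
    - 2 * \sum_(l < n | (l < i)%N) \sum_(r < 2 * n | (r < j)%N) M l r).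

Definition height_boundary (n : nat) (M : 'M[int]_(n, 2 * n)) : bool :=
  [forall i : 'I_n.+1, height M ord_max (inord (2 * i)) == n%:Z].

(* Matrices with coefficients in 'seq_sub asm_values' form a finite type, so   *)
(* that sets of them and sums over these sets are available.                   *)
Definition int_mx (n : nat) (A : 'M[seq_sub asm_values]_(n, 2 * n)) : 'M[int]_(n, 2 * n) :=
  map_mx val A.

Definition Hset (n : nat) : {set 'M[seq_sub asm_values]_(n, 2 * n)} :=
  [set A | halved_asm (int_mx A) && height_boundary (int_mx A)].

Definition Nminus_even (n : nat) (M : 'M[int]_(n, 2 * n)) : nat :=
  #|[set p : 'I_n * 'I_(2 * n) | ~~ odd (p.1 + p.2) & M p.1 p.2 == -1]|.

Definition Nplus_odd (n : nat) (M : 'M[int]_(n, 2 * n)) : nat :=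
  #|[set p : 'I_n * 'I_(2 * n) | odd (p.1 + p.2) & M p.1 p.2 == 1]|.

(* Main.v *)
(* Record a halved ASM by the sets S_0 = set0, S_1, ..., S_n, where S_i is the  *)
(* set of columns whose first i entries sum to 1. Consecutive sets interlace,   *)
(* and the boundary condition says that S_n contains exactly one of the columns *)
(* 2q, 2q+1 for each q < n. At every cell the weights of the entries 1 and -1   *)
(* multiply to 2 (1 and 2, or 2 and 1), which is the free fermion condition:    *)
(* the generating function of the paths that end at S_i = {k_0 < k_1 < ...} is  *)
(* then a determinant det(f_p(k_q)), where the functions f_p for i+1 come from  *)
(* those for i by a discrete trapezoid integration. The sum over S_n is again a *)
(* determinant, det(f_p(2q) + f_p(2q+1)). Each f_p(2q) + f_p(2q+1) is a         *)
(* polynomial in q of degree p, and every integration multiplies the leading    *)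
(* coefficient in the basis 'C(q, p) by 2 * (1/2 + 2) = 5, starting from        *)
(* 1 + 2 = 3; so the determinant is the product of the 3 * 5 ^ p for p < n.     *)

Require Import Defs.
From mathcomp Require Import all_boot all_order all_algebra.
From mathcomp Require Import perm zify ring.
Set Implicit Arguments.
Unset Strict Implicit.
Unset Printing Implicit Defensive.
Import Order.TTheory GRing.Theory Num.Theory.
Local Open Scope ring_scope.

(** * Alternating sequences and partial sums *)

(** A column with first non-zero entry 1, or a row of sum 1, alternates exactly when its partial
    sums stay in {0, 1}. So halved ASMs are chains of interlacing column sets that gain one element
    per row ([halved_asmP], [halved_states_mx]), and [sum_paths] evaluates the weighted sum by a
    transfer operator.

    A row contributes w k for each new element k and (2 - [x is new]) / w x for each old element x.
    Interlacing puts the q-th old element between two consecutive new ones, and it can be new only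
    as an endpoint. The old elements thus carry separate trapezoid weights, and a Cauchy-Binet
    argument ([det_sum_sets]) makes the sum of minors a single minor ([minor_transfer]).

    The boundary condition also constrains each element separately, so [det_sum_sets] applies again
    ([sum_transversal_minors]). The resulting entries are polynomials in q, whose leading
    coefficients ([orbital_expansion]) multiply to the determinant ([det_binomial_expansion]). *)

Lemma nonzeros_sign (s : seq int) : all (mem asm_values) s ->
  all (mem [:: 1; -1]) (nonzeros s).
Proof.
move=> sv; apply/allP=> x; rewrite mem_filter => /andP[x0 /(allP sv)].
by rewrite !inE (negPf x0).
Qed.

(** [c] is the running partial sum: it is 1 just after an entry 1 and 0 just after an entry -1, so a
    non-zero entry keeps it in {0, 1} exactly when the sign changes. *)
Lemma path_alternating (c : bool) (s : seq int) : all (mem asm_values) s ->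
  reflect (forall x, 0 <= c%:R + \sum_(y <- take x s) y <= 1)
          (path (fun x y => x * y < 0) (if c then 1 else -1) (nonzeros s)).
Proof.
elim: s c => [|y s IH] c /=.
  by move=> _; left=> x; rewrite big_nil addr0; case: c.
case/andP=> yv /IH {}IH.
have shift (d : bool) : c%:R + y = d%:R :> int ->
  (forall x, 0 <= d%:R + \sum_(z <- take x s) z <= 1) <->
  (forall x, 0 <= c%:R + \sum_(z <- take x (y :: s)) z <= 1).
  move=> e; split=> H x; last first.
    by have := H x.+1; rewrite /= big_cons addrA e.
  case: x => [|x] /=; first by rewrite big_nil addr0; case: (c).
  by rewrite big_cons addrA e; apply: H.
have bad : ~~ (0 <= c%:R + y <= 1) ->
  ~ (forall x, 0 <= c%:R + \sum_(z <- take x (y :: s)) z <= 1).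
  by move=> /negP e H; apply: e; have := H 1%N; rewrite /= take0 big_seq1.
move: yv; rewrite !inE /nonzeros /=; case: (eqVneq y 0) shift bad => [-> shift _ _|_] /=.
  exact: (iffP (IH c) (proj1 (shift _ (addr0 _))) (proj2 (shift _ (addr0 _)))).
case: (eqVneq y 1) => [-> shift bad _|_ shift bad /eqP yE] /=.
- case: c shift bad => shift bad /=; first by right; apply: bad.
  exact: (iffP (IH true) (proj1 (shift true (add0r _))) (proj2 (shift true (add0r _)))).
- rewrite yE in shift bad *; case: c shift bad => shift bad /=; last by right; apply: bad.
  exact: (iffP (IH false) (proj1 (shift false (subrr _))) (proj2 (shift false (subrr _)))).
Qed.

Lemma alternating_head1 (s : seq int) : all (mem asm_values) s ->
  reflect (forall x, 0 <= \sum_(y <- take x s) y <= 1)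
          (alternating s && (head 1 (nonzeros s) == 1)).
Proof.
move=> sv; have := path_alternating false sv.
have -> : alternating s && (head 1 (nonzeros s) == 1)
     = path (fun x y => x * y < 0) (-1) (nonzeros s).
  have := nonzeros_sign sv; rewrite /alternating; case: (nonzeros s) => [|x u] //= /andP[+ _].
  by rewrite andbC !inE => /orP[] /eqP->.
by move=> H; apply: (iffP H) => {}H x; have := H x; rewrite add0r.
Qed.

Lemma alternating_sum1 (s : seq int) : all (mem asm_values) s ->
  reflect ((forall x, 0 <= \sum_(y <- take x s) y <= 1) /\ \sum_(y <- s) y = 1)
          (alternating s && (\sum_(y <- s) y == 1)).
Proof.
move=> sv; apply: (iffP andP) => [[alts /eqP s1]|[/(alternating_head1 sv) /andP[-> _] ->]] //.
split=> //; apply/(alternating_head1 sv); rewrite alts /=.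
(* If the first non-zero entry were -1, the sequence would still alternate behind an extra 1, so 1
   plus the total would be at most 1. *)
case: eqP => // hd; have /elimT H := path_alternating true sv.
have /H/(_ (size s)) : path (fun x y => x * y < 0) 1 (nonzeros s); last by rewrite take_size s1.
have := nonzeros_sign sv; move: alts hd; rewrite /alternating.
case: (nonzeros s) => [|x u] //= + hd /andP[+ _].
by rewrite !inE => /[swap] /orP[] /eqP xE; rewrite xE in hd *.
Qed.

Lemma sum_take_ord N (F : 'I_N -> int) x :
  \sum_(y <- take x [seq F j | j <- enum 'I_N]) y = \sum_(r < N | (r < x)%N) F r.
Proof.
set s := [seq F j | j <- _].
have sN : size s = N by rewrite size_map size_enum_ord.
have -> : \sum_(r < N | (r < x)%N) F r = \sum_(r < N | (r < x)%N) nth 0 s r.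
  by apply: eq_bigr => r _; rewrite (nth_map r) ?size_enum_ord // nth_ord_enum.
rewrite (big_nth 0) size_take_min sN big_mkord.
under eq_bigr => i _ do rewrite nth_take ?(leq_trans (ltn_ord i)) ?geq_minl //.
rewrite (big_ord_widen N (nth 0 s)) ?geq_minr //.
by apply: eq_bigl => r; rewrite leq_min ltn_ord andbT.
Qed.

(** * Minors indexed by sets of columns *)

Definition elements N (S : {set 'I_N}) : seq nat := [seq val j | j <- enum S].

Definition below N (S : {set 'I_N}) (x : nat) : nat :=
  #|[set j in S | (j < x)%N]|.

Lemma size_elements N (S : {set 'I_N}) : size (elements S) = #|S|.
Proof. by rewrite size_map -cardE. Qed.

Lemma elements_sorted N (S : {set 'I_N}) : sorted ltn (elements S).
Proof.
rewrite /elements sorted_map /enum_mem -enumT /=.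
apply: sorted_filter; first by move=> a b c; apply: ltn_trans.
by rewrite -sorted_map val_enum_ord iota_ltn_sorted.
Qed.

Lemma mem_elements N (S : {set 'I_N}) (j : 'I_N) : (val j \in elements S) = (j \in S).
Proof. by rewrite mem_map ?mem_enum //; apply: val_inj. Qed.

Lemma below_count N (S : {set 'I_N}) x : below S x = count (ltn^~ x) (elements S).
Proof.
rewrite /below /elements count_map cardE /enum_mem size_filter count_filter.
by apply: eq_count => j /=; rewrite inE andbC.
Qed.

Lemma ltn_sorted_count (s : seq nat) j x : sorted ltn s -> (j < size s)%N ->
  (nth 0 s j < x)%N = (j < count (ltn^~ x) s)%N.
Proof.
elim: s j => // y s IH j /= ys; have /= /allP y_lt := order_path_min ltn_trans ys.
have {}IH := IH ^~ (path_sorted ys).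
have c0 : (x <= y)%N -> count (ltn^~ x) s = 0%N.
  move=> xy; apply/eqP; rewrite -leqn0 leqNgt -has_count; apply/hasPn=> z /y_lt.
  by rewrite -leqNgt; lia.
case: j => [|j] /=; first by case: (ltnP y x) => [_|/c0->].
rewrite ltnS => js; rewrite IH //; case: (ltnP y x) => [_|/c0 c].
  by rewrite add1n.
by rewrite c.
Qed.

(** Translates between counts, which are partial sums of rows, and the increasing enumeration, which
    indexes the minors. *)
Lemma nth_elements_lt N (S : {set 'I_N}) j x : (j < #|S|)%N ->
  (nth 0 (elements S) j < x)%N = (j < below S x)%N.
Proof.
by rewrite -size_elements below_count; apply/ltn_sorted_count/elements_sorted.
Qed.

Lemma below_le_card N (S : {set 'I_N}) x : (below S x <= #|S|)%N.
Proof. by apply/subset_leq_card/subsetP=> j; rewrite inE => /andP[]. Qed.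

Lemma below_full N (S : {set 'I_N}) x : (N <= x)%N -> below S x = #|S|.
Proof.
move=> Nx; apply: eq_card => j; rewrite inE (leq_trans (ltn_ord j) Nx).
by rewrite andbT.
Qed.

Lemma elements_image N m (l : 'I_m -> 'I_N) :
  (forall q r : 'I_m, (q < r)%N -> (l q < l r)%N) ->
  elements [set l q | q in 'I_m] = [seq val (l q) | q <- enum 'I_m].
Proof.
move=> lh; apply: (irr_sorted_eq ltn_trans ltnn); first exact: elements_sorted.
  apply: (homo_sorted (e := relpre val ltn)); first exact: lh.
  by rewrite -sorted_map val_enum_ord iota_ltn_sorted.
move=> x; apply/mapP/mapP => [[j]|[q _ ->]].
  by rewrite mem_enum => /imsetP[q _ ->] ->; exists q; rewrite ?mem_enum.
by exists (l q); rewrite ?mem_enum ?imset_f.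
Qed.

(** Multilinearity in the columns: [l] chooses one summand in each column. *)
Lemma det_sum_col (R : comNzRingType) (T : finType) m (tau : 'I_m -> T -> R)
    (f : 'I_m -> T -> R) :
  \det (\matrix_(p, q) \sum_x tau q x * f p x) =
  \sum_(l : {ffun 'I_m -> T}) (\prod_q tau q (l q)) * \det (\matrix_(p, q) f p (l q)).
Proof.
rewrite -det_tr {1}/determinant.
under eq_bigr => s _.
  under eq_bigr => q _ do rewrite !mxE.
  rewrite (bigA_distr_bigA (fun q x => tau q x * f (s q) x)) mulr_sumr; over.
rewrite exchange_big /=; apply: eq_bigr => l _; rewrite -det_tr /determinant mulr_sumr.
apply: eq_bigr => s _; rewrite big_split /= mulrCA; congr (_ * (_ * _)).
by apply: eq_bigr => q _; rewrite !mxE.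
Qed.

Definition minor (R : comNzRingType) m N (f : nat -> nat -> R) (S : {set 'I_N}) : R :=
  \det (\matrix_(p < m, q < m) f p (nth 0%N (elements S) q)).

(* The determinant kills the index functions with a repeated value, and the     *)
(* hypothesis on the supports leaves only the increasing ones, that is, sets.  *)
Lemma det_sum_sets (R : comNzRingType) m N (tau : 'I_m -> nat -> R) (f : nat -> nat -> R) :
  (forall (q r : 'I_m) x y, (q < r)%N -> tau q x != 0 -> tau r y != 0 -> (x <= y)%N) ->
  \det (\matrix_(p, q) \sum_(x < N) tau q x * f p x) =
  \sum_(S : {set 'I_N} | #|S| == m)
     (\prod_q tau q (nth 0%N (elements S) q)) * minor m f S.
Proof.
move=> tau_le; rewrite (det_sum_col (fun q (x : 'I_N) => tau q x) (fun p (x : 'I_N) => f p x)).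
pose incr (l : {ffun 'I_m -> 'I_N}) :=
  [forall q : 'I_m, forall r : 'I_m, (q < r)%N ==> (l q < l r)%N].
have incrP (l : {ffun 'I_m -> 'I_N}) :
    reflect (forall q r : 'I_m, (q < r)%N -> (l q < l r)%N) (incr l).
  apply: (iffP forallP) => [H q r|H q]; first by have /forallP/(_ r)/implyP := H q.
  by apply/forallP=> r; apply/implyP/H.
rewrite (bigID incr) /= addrC big1 ?add0r; last first.
  move=> l; have [tau0|] := boolP [exists q, tau q (l q) == 0].
    by case/existsP: tau0 => q /eqP tq _; rewrite (bigD1 q) //= tq !mul0r.
  rewrite negb_exists => /forallP tau_n0 /forallPn[q /forallPn[r]].
  rewrite negb_imply -leqNgt => /andP[qr rq].
  have /val_inj lqr : val (l q) = l r.
    by apply/eqP; rewrite eqn_leq rq (tau_le q r).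
  rewrite -det_tr (@determinant_alternate _ _ _ q r) ?mulr0 //.
    by apply: contraTneq qr => ->; rewrite ltnn.
  by move=> p; rewrite !mxE lqr.
rewrite (partition_big (fun l : {ffun _} => [set l q | q in 'I_m])
  (fun S => #|S| == m)) /=; last first.
  move=> l /incrP lh; rewrite card_imset ?card_ord // => q r e.
  by apply/val_inj; case: (ltngtP q r) => // /lh; rewrite e ltnn.
apply: eq_bigr => S /eqP cS.
(* The increasing enumeration of [S] is the only increasing index function with image [S]. *)
pose l0 := [ffun q : 'I_m => enum_val (cast_ord (esym cS) q)].
have l0E q : val (l0 q) = nth 0%N (elements S) q.
  rewrite ffunE /elements (nth_map (enum_val (cast_ord (esym cS) q))); last by rewrite -cardE cS.
  by congr val; apply: set_nth_default; rewrite -cardE; apply: ltn_ord.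
rewrite (big_pred1 l0) /minor.
  congr (_ * _); first by apply: eq_bigr => q _; rewrite l0E.
  by congr (\det _); apply/matrixP=> p q; rewrite !mxE l0E.
move=> l; apply/andP/eqP => [[/incrP lh /eqP lS]|->].
  apply/ffunP=> q; apply/val_inj; rewrite l0E -lS elements_image //.
  by rewrite (nth_map q) ?size_enum_ord // nth_ord_enum.
split.
  apply/incrP=> q r qr /=; rewrite !l0E.
  by apply: (sorted_ltn_nth ltn_trans _ (elements_sorted S)); rewrite ?inE ?size_elements ?cS.
rewrite eqEcard card_imset ?cS ?card_ord ?leqnn ?andbT.
  by apply/subsetP=> _ /imsetP[q _ ->]; rewrite ffunE enum_valP.
by move=> q r; rewrite !ffunE => /enum_val_inj/cast_ord_inj.
Qed.

(** * Transfer of one row *)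

(** Subtracting from each column its predecessor, that is, multiplying by the unipotent [U], turns
    the row of ones into (1, 0, ..., 0). *)
Lemma det_ones_diff (R : comNzRingType) m (g : nat -> nat -> R) :
  \det (\matrix_(p < m.+1, q < m.+1) if val p is p'.+1 then g p' q else 1) =
  \det (\matrix_(p < m, q < m) (g p q.+1 - g p q)).
Proof.
set A := (\matrix_(p, q) _ : 'M_m.+1).
pose U : 'M[R]_m.+1 := \matrix_(q, r) ((q == r)%:R - (q.+1 == r)%:R).
have dU : \det U = 1.
  rewrite -det_tr det_trig.
    by apply: big1 => q _; rewrite !mxE eqxx gtn_eqF ?subr0.
  apply/is_trig_mxP=> q r qr; rewrite !mxE -val_eqE /= !gtn_eqF ?subrr //.
  exact: leqW.
have AU p r : (A *m U) p r = A p r - (if val r is r'.+1 then A p (inord r') else 0).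
  rewrite mxE.
  under eq_bigr => q _ do rewrite [U _ _]mxE mulrBr !mulr_natr !mulrb.
  rewrite sumrB -big_mkcond big_pred1_eq; congr (_ - _).
  rewrite -big_mkcond; case: r => -[|r] r_lt /=; first exact: big_pred0.
  apply: big_pred1 => q; rewrite /= eqSS -val_eqE /= inordK //; exact: ltnW.
rewrite -[LHS]mulr1 -dU -det_mulmx (expand_det_row _ ord0) big_ord_recl big1 ?addr0.
  rewrite AU mxE subr0 mul1r /cofactor addn0 mul1r; congr (\det _).
  apply/matrixP=> p q; rewrite [LHS]mxE mxE AU !mxE /= /bump add1n.
  by rewrite mxE /= !add0n inordK // ltnW // ltnS.
by move=> q _; rewrite AU /= !mxE subrr mul0r.
Qed.

Lemma prod_elements (R : comNzRingType) N (S : {set 'I_N}) (F : nat -> R) :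
  \prod_(j in S) F j = \prod_(q < #|S|) F (nth 0%N (elements S) q).
Proof.
rewrite -(big_mkord xpredT (fun q => F (nth 0%N (elements S) q))).
by rewrite -size_elements -(big_nth _ xpredT) big_map big_enum.
Qed.

(* Twice the trapezoid rule on [0, k], up to the constant g 0. *)
Definition trapezoid_sum (R : nzRingType) (g : nat -> R) (k : nat) : R :=
  g k + 2 * \sum_(l < k) g l.

(** For a < b: weight 2 inside the interval, 1 at both ends, 0 outside. *)
Definition trapezoid (R : nzRingType) (a b x : nat) : R :=
  (a <= x <= b)%N%:R * (2 - (x == a)%:R - (x == b)%:R).

Lemma sum_trapezoid (R : comNzRingType) N a b (g : nat -> R) :
  (a < b)%N -> (b < N)%N ->
  \sum_(x < N) trapezoid R a b x * g x = trapezoid_sum g b - trapezoid_sum g a.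
Proof.
move=> ab bN; have mul_bool (c : bool) y : c%:R * y = if c then y else 0 :> R.
  by case: c; rewrite ?mul1r ?mul0r.
have sumE k : (k < N)%N ->
    trapezoid_sum g k = \sum_(x < N) ((x == k :> nat)%:R + 2 * (x < k)%N%:R) * g x.
  move=> kN; rewrite /trapezoid_sum (big_ord_widen _ _ (ltnW kN)).
  under [RHS]eq_bigr => x _ do rewrite mulrDl -mulrA !mul_bool.
  rewrite big_split /= -mulr_sumr -!big_mkcond /=; congr (_ + _).
  by rewrite (big_pred1 (Ordinal kN)).
rewrite !sumE ?(ltn_trans ab) // -sumrB; apply: eq_bigr => x _.
rewrite -mulrBl; congr (_ * _); rewrite /trapezoid.
case: (ltngtP x a) => xa; case: (ltngtP x b) => xb; rewrite /=; try lia; by ring.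
Qed.

(** The difference of the two counts is a partial sum of the row, which must be 0 or 1. *)
Definition interlaced N (S S' : {set 'I_N}) : bool :=
  [forall x : 'I_N.+1, below S x <= below S' x <= (below S x).+1]%N.

Lemma interlacedP N (S S' : {set 'I_N}) : #|S'| = #|S|.+1 ->
  reflect (forall q, (q < #|S|)%N ->
    (nth 0 (elements S') q <= nth 0 (elements S) q <= nth 0 (elements S') q.+1)%N)
  (interlaced S S').
Proof.
move=> cS; apply: (iffP forallP) => [H q qS|H x].
  have {}H x : (below S x <= below S' x <= (below S x).+1)%N.
    case: (ltnP x N.+1) => [xN|/ltnW xN]; first exact: (H (Ordinal xN)).
    by rewrite !below_full // cS leqnSn leqnn.
  apply/andP; split.
    (* Counts are compared just past the q-th element, so that it is itself counted. *)
    rewrite -ltnS nth_elements_lt ?cS ?(leqW qS) //.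
    have /andP[+ _] := H (nth 0 (elements S) q).+1; apply: leq_trans.
    by rewrite -nth_elements_lt.
  rewrite -ltnS nth_elements_lt //.
  have /andP[_ le] := H (nth 0 (elements S') q.+1).+1.
  by rewrite -ltnS; apply: leq_trans le; rewrite -nth_elements_lt ?cS.
apply/andP; split; rewrite leqNgt; apply/negP => lt.
  have := leq_trans lt (below_le_card S x) => qS.
  have /andP[+ _] := H _ qS; rewrite leqNgt => /negP[].
  move: lt; rewrite -nth_elements_lt // => /leq_trans -> //.
  by rewrite leqNgt nth_elements_lt ?ltnn // cS ltnW.
have := leq_trans lt (below_le_card S' x); rewrite cS ltnS => qS.
have /andP[_] := H _ qS; rewrite leqNgt => /negP[].
have : (nth 0 (elements S') (below S x).+1 < x)%N by rewrite nth_elements_lt ?cS.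
by move=> /leq_trans -> //; rewrite leqNgt nth_elements_lt ?ltnn.
Qed.

Section Transfer.
Variables (F : fieldType) (w : nat -> F).
Hypothesis w_neq0 : forall k, w k != 0.

(* [s] and [s'] are the column partial sums above and below the cell, so that  *)
(* the entry is s' - s; the two non-zero entries have weights of product 2.    *)
Definition cell_weight (s s' : bool) (j : nat) : F :=
  if s' then (if s then 1 else w j) else (if s then 2 / w j else 1).

Definition row_weight N (S S' : {set 'I_N}) : F :=
  (interlaced S S')%:R * \prod_(j < N) cell_weight (j \in S) (j \in S') j.

Definition transfer (f : nat -> nat -> F) (p k : nat) : F :=
  w k * if p is p'.+1 then trapezoid_sum (fun l => f p' l / w l) k else 1.

(** The product 2 of the two non-zero weights lets each cell split into a factor for S' and a factor
    for S. If interlacing fails, some trapezoid weight vanishes. *)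
Lemma row_weight_trapezoid N m (S S' : {set 'I_N}) : #|S| = m -> #|S'| = m.+1 ->
  row_weight S S' = (\prod_(q < m.+1) w (nth 0%N (elements S') q)) *
    \prod_(q < m) (trapezoid F (nth 0%N (elements S') q) (nth 0%N (elements S') q.+1)
       (nth 0%N (elements S) q) / w (nth 0%N (elements S) q)).
Proof.
move=> cS cS'; rewrite /row_weight.
have [|ni] := interlacedP (etrans cS' (congr1 _ (esym cS))); last first.
  rewrite mul0r; have [q qE] : exists q : 'I_m,
     ~~ (nth 0 (elements S') q <= nth 0 (elements S) q <= nth 0 (elements S') q.+1)%N.
    apply/existsP; rewrite -negb_forall; apply/negP=> /forallP H; apply: ni => q.
    by rewrite cS => qm; apply: (H (Ordinal qm)).
  by rewrite [X in _ * X](bigD1 q) //= /trapezoid (negPf qE) !mul0r mulr0.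
rewrite cS mul1r => inter.
have -> : \prod_(j < N) cell_weight (j \in S) (j \in S') j =
   (\prod_(j in S') w j) * \prod_(j in S) ((2 - (val j \in elements S')%:R) / w j).
  rewrite !(big_mkcond (fun j => j \in _)) -big_split /=; apply: eq_bigr => j _.
  rewrite mem_elements /cell_weight; case: (j \in S'); case: (j \in S) => /=.
  - by rewrite -natrB // mulrC -mulrA mulVf ?mulr1.
  - by rewrite mulr1.
  - by rewrite subr0 mul1r.
  - by rewrite mulr1.
rewrite prod_elements (prod_elements S (fun x => (2 - (x \in elements S')%:R) / w x)).
rewrite cS cS'; congr (_ * _); apply: eq_bigr => q _; congr (_ / _).
have /= := inter q (ltn_ord q); set x := nth _ (elements S) _ => /andP[ax xb].
rewrite /trapezoid ax xb mul1r -[RHS]addrA -opprD -natrD; congr (2 - _%:R).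
have lt := sorted_ltn_nth ltn_trans 0%N (elements_sorted S').
have in_q r : (r <= m)%N -> r \in gtn (size (elements S')) by rewrite inE size_elements cS'.
have /(_ (leqnSn q)) kk : (q <= q.+1)%N -> (nth 0 (elements S') q < nth 0 (elements S') q.+1)%N.
  by move=> _; apply: lt; rewrite ?in_q // ltnW.
(* The index [r] of [x] in S' can only be q or q.+1, so [x] is an endpoint of its interval. *)
case: (boolP (x \in elements S')) => [xS'|xS'].
  have := xS'; rewrite -index_mem size_elements cS' ltnS => r_lt.
  have xr := nth_index 0%N xS'; set r := index _ _ in r_lt xr.
  have qr : (q <= r)%N.
    rewrite leqNgt; apply/negP => rq; have := lt _ _ (in_q _ r_lt) (in_q _ (ltnW (ltn_ord q))) rq.
    by rewrite xr ltnNge ax.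
  have rq : (r <= q.+1)%N.
    rewrite leqNgt; apply/negP => rq; have := lt _ _ (in_q _ (ltn_ord q)) (in_q _ r_lt) rq.
    by rewrite xr ltnNge xb.
  have /orP[/eqP re|/eqP re] : (r == q) || (r == q.+1) by lia.
    by rewrite -re xr eqxx -xr re ltn_eqF.
  by rewrite -re xr eqxx -xr re gtn_eqF.
case: eqP => [xE|_].
  by case/negP: xS'; rewrite xE mem_nth // size_elements cS' leqW.
case: eqP => [xE|//].
by case/negP: xS'; rewrite xE mem_nth // size_elements cS' ltnS.
Qed.

(** With [w] pulled out of the columns, the function p = 0 gives a row of ones; column differences
    then turn the trapezoid sums into sums over the intervals [k q, k q.+1]. These are ordered and
    overlap at most in endpoints, as [det_sum_sets] requires. *)
Lemma minor_transfer N m (f : nat -> nat -> F) (S' : {set 'I_N}) : #|S'| = m.+1 ->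
  \sum_(S : {set 'I_N} | #|S| == m) minor m f S * row_weight S S' =
  minor m.+1 (transfer f) S'.
Proof.
move=> cS'; set k := nth 0%N (elements S').
have k_lt q : (q < m.+1)%N -> (k q < N)%N.
  move=> qm; have : k q \in elements S' by rewrite mem_nth ?size_elements ?cS'.
  by case/mapP=> j _ ->; apply: ltn_ord.
have k_incr q r : (q < r)%N -> (r < m.+1)%N -> (k q < k r)%N.
  move=> qr rm; apply: (sorted_ltn_nth ltn_trans 0%N (elements_sorted S')) => //.
    by rewrite inE size_elements cS' (ltn_trans qr).
  by rewrite inE size_elements cS'.
pose g p x := f p x / w x.
have -> : minor m.+1 (transfer f) S' = (\prod_(q < m.+1) w (k q)) *
   \det (\matrix_(p < m.+1, q < m.+1) if val p is p'.+1 then trapezoid_sum (g p') (k q) else 1).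
  transitivity (\det ((\matrix_(p < m.+1, q < m.+1)
     if val p is p'.+1 then trapezoid_sum (g p') (k q) else 1)
     *m diag_mx (\row_q w (k q)))).
    congr (\det _); apply/matrixP=> p q; rewrite mul_mx_diag !mxE mulrC.
    by case: p => -[|p] plt.
  rewrite det_mulmx det_diag mulrC; congr (_ * _).
  by apply: eq_bigr => q _; rewrite mxE.
rewrite (det_ones_diff m (fun p q => trapezoid_sum (g p) (k q))).
have -> : \matrix_(p < m, q < m) (trapezoid_sum (g p) (k q.+1) - trapezoid_sum (g p) (k q))
   = \matrix_(p < m, q < m) \sum_(x < N) (trapezoid F (k q) (k q.+1) x / w x) * f p x.
  apply/matrixP=> p q; rewrite !mxE -(@sum_trapezoid _ N) ?k_lt ?k_incr ?ltnS //.
  by apply: eq_bigr => x _; rewrite /g -!mulrA [(w x)^-1 * _]mulrC.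
rewrite (det_sum_sets N (tau := fun (q : 'I_m) x => trapezoid F (k q) (k q.+1) x / w x)).
  rewrite mulr_sumr; apply: eq_bigr => S /eqP cS.
  by rewrite (row_weight_trapezoid cS cS') mulrC -mulrA.
have nat_neq0 (c : bool) : c%:R != 0 :> F -> c by case: c; rewrite ?eqxx.
move=> q r x y qr; rewrite /trapezoid !mulf_eq0 !negb_or -!andbA.
case/and3P=> /nat_neq0/andP[_ xk] _ _ /and3P[/nat_neq0/andP[ky _] _ _].
apply: leq_trans xk (leq_trans _ ky).
move: qr; rewrite leq_eqVlt => /predU1P[-> //|qr]; apply/ltnW/k_incr => //.
by rewrite ltnS ltnW.
Qed.

End Transfer.

(** * Evaluation of the determinant *)

Section BinomialExpansion.
Variable R : comNzRingType.

(* [c] is the coefficient of 'C(q, d) and may vanish. *)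
Definition binomial_expansion (d : nat) (c : R) (g : nat -> R) : Prop :=
  exists2 a : nat -> R, a d = c & forall q, g q = \sum_(t < d.+1) a t * 'C(q, t)%:R.

Lemma binomial_expansion_const c : binomial_expansion 0 c (fun=> c).
Proof. by exists (fun=> c) => // q; rewrite big_ord1 bin0 mulr1. Qed.

Lemma binomial_expansionD d c c' g g' :
  binomial_expansion d c g -> binomial_expansion d c' g' ->
  binomial_expansion d (c + c') (fun q => g q + g' q).
Proof.
move=> [a <- gE] [a' <- g'E]; exists (fun t => a t + a' t) => // q.
by rewrite gE g'E -big_split; apply: eq_bigr => t _; rewrite mulrDl.
Qed.

Lemma binomial_expansionZ d c b g :
  binomial_expansion d c g -> binomial_expansion d (b * c) (fun q => b * g q).
Proof.
move=> [a <- gE]; exists (fun t => b * a t) => // q.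
by rewrite gE mulr_sumr; apply: eq_bigr => t _; rewrite mulrA.
Qed.

Lemma binomial_expansion_lift d c g :
  binomial_expansion d c g -> binomial_expansion d.+1 0 g.
Proof.
move=> [a _ gE]; exists (fun t => if (t <= d)%N then a t else 0); first by rewrite /= ltnn.
move=> q; rewrite gE [RHS]big_ord_recr /= ltnn mul0r addr0.
by apply: eq_bigr => t _; rewrite -ltnS ltn_ord.
Qed.

(** By Pascal's rule, summation shifts the binomial basis by one degree. *)
Lemma binomial_expansion_sum d c g :
  binomial_expansion d c g -> binomial_expansion d.+1 c (fun q => \sum_(l < q) g l).
Proof.
move=> [a ad gE]; exists (fun t => if t is t'.+1 then a t' else 0) => // q.
rewrite big_ord_recl mul0r add0r.
elim: q => [|q IH]; first by rewrite big_ord0 big1 // => t _; rewrite bin0n mulr0.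
rewrite big_ord_recr /= IH gE -big_split; apply: eq_bigr => t _ /=.
by rewrite -mulrDr -natrD binS addnC.
Qed.

Lemma eq_binomial_expansion d c c' g g' : c = c' -> g =1 g' ->
  binomial_expansion d c g -> binomial_expansion d c' g'.
Proof. by move=> -> gg' [a ad gE]; exists a => // q; rewrite -gg'. Qed.

(** The matrix is a lower triangular matrix of coefficients times the upper unitriangular matrix of
    binomials. *)
Lemma det_binomial_expansion m (c : nat -> R) (f : nat -> nat -> R) :
  (forall p, (p < m)%N -> binomial_expansion p (c p) (f p)) ->
  \det (\matrix_(p < m, q < m) f p q) = \prod_(p < m) c p.
Proof.
move=> H; have /fin_all_exists2[a ac fE] : forall p : 'I_m, exists2 a : nat -> R,
    a p = c p & forall q, f p q = \sum_(t < p.+1) a t * 'C(q, t)%:R.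
  by move=> p; apply: H.
have -> : \matrix_(p < m, q < m) f p q =
    (\matrix_(p < m, t < m) if (t <= p)%N then a p t else 0) *m
    (\matrix_(t < m, q < m) 'C(q, t)%:R).
  apply/matrixP=> p q; rewrite !mxE fE.
  rewrite (big_ord_widen m (fun t => a p t * 'C(q, t)%:R)) // big_mkcond.
  by apply: eq_bigr => t _; rewrite !mxE ltnS; case: leqP; rewrite ?mul0r.
rewrite det_mulmx det_trig; last first.
  by apply/is_trig_mxP => p t pt; rewrite mxE leqNgt pt.
rewrite -(det_tr (\matrix_(t, q) _)) det_trig; last first.
  by apply/is_trig_mxP => p t pt; rewrite !mxE bin_small.
rewrite [X in _ * X]big1 ?mulr1; last by move=> p _; rewrite !mxE binn.
by apply: eq_bigr => p _; rewrite mxE leqnn ac.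
Qed.

End BinomialExpansion.

(** * The functions in the determinant and their leading coefficients *)

(* The entry -1 has weight 2 / plus_weight i k. *)
Definition plus_weight (i k : nat) : rat := if odd (i + k) then 2 else 1.

Fixpoint orbital (i : nat) : nat -> nat -> rat :=
  if i is i'.+1 then transfer (plus_weight i') (orbital i') else fun _ _ => 0.

Lemma plus_weight_neq0 i k : plus_weight i k != 0.
Proof. by rewrite /plus_weight; case: odd. Qed.

Lemma sum_pairs (g : nat -> rat) q :
  \sum_(l < q.*2) g l = \sum_(l < q) (g l.*2 + g l.*2.+1).
Proof.
elim: q => [|q IH]; first by rewrite !big_ord0.
by rewrite doubleS !big_ord_recr /= IH addrA.
Qed.

Lemma plus_weight_pair j (b : bool) q : plus_weight j (b + q.*2) = plus_weight j b.
Proof. by rewrite /plus_weight !oddD odd_double addbF. Qed.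

(** From one row to the next the weights 1 and 2 are exchanged within each pair of columns, so
    summing over a pair multiplies the leading coefficient by 1/2 + 2; the factor 2 of the trapezoid
    rule makes this 5. *)
Lemma orbital_expansion i p (b : bool) : (p <= i)%N ->
  binomial_expansion p (5 ^+ p * plus_weight i b) (fun q => orbital i.+1 p (b + q.*2)).
Proof.
have const j (c : bool) : binomial_expansion 0 (5 ^+ 0 * plus_weight j c)
    (fun q => orbital j.+1 0 (c + q.*2)).
  apply: eq_binomial_expansion (binomial_expansion_const _); first by rewrite expr0 mul1r.
  by move=> q; rewrite /= /transfer mulr1 plus_weight_pair.
elim: i p b => [|i IH] [|p] b // pi.
pose w c := plus_weight i.+1 (c : bool); pose f := orbital i.+1 p.
have fw (c : bool) :
    binomial_expansion p ((w c)^-1 * (5 ^+ p * plus_weight i c))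
      (fun q => (w c)^-1 * f (c + q.*2)%N).
  exact/binomial_expansionZ/IH.
have half := binomial_expansion_sum (binomial_expansionD (fw false) (fw true)).
(* The end term, and column 2q when b = 1, stay of degree p and add nothing to the coefficient of
   degree p.+1. *)
have zero := binomial_expansion_lift (fw false).
have zeroZ := binomial_expansionZ (b%:R * 2) zero.
have all := binomial_expansionZ (w b) (binomial_expansionD
  (binomial_expansionD (binomial_expansion_lift (fw b)) zeroZ) (binomial_expansionZ 2 half)).
apply: eq_binomial_expansion all.
  rewrite /w /plus_weight exprS !addnS !addn0 /=.
  by case: b {fw zeroZ zero half} => /=; rewrite ?addn0 ?addn1 /=; case: (odd i) => /=; field.
move=> q; have -> : orbital i.+2 p.+1 (b + q.*2) = plus_weight i.+1 (b + q.*2) *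
    trapezoid_sum (fun l => f l / plus_weight i.+1 l) (b + q.*2) by [].
rewrite plus_weight_pair -/(w b); congr (_ * _); rewrite /trapezoid_sum.
have gE (c : bool) l : f (c + l.*2)%N / plus_weight i.+1 (c + l.*2) = (w c)^-1 * f (c + l.*2)%N.
  by rewrite plus_weight_pair mulrC.
rewrite /= gE -addrA; congr (_ + _).
have sE : \sum_(l < q.*2) f l / plus_weight i.+1 l =
    \sum_(l < q) ((w false)^-1 * f (false + l.*2)%N + (w true)^-1 * f (true + l.*2)%N).
  rewrite (sum_pairs (fun l => f l / plus_weight i.+1 l)); apply: eq_bigr => l _.
  by rewrite (gE false) (gE true).
clear IH; clearbody f; case: b {fw zeroZ zero half} => /=.
  by rewrite (big_ord_recr q.*2) /= sE (gE false) mul1r mulrDr addrC.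
by rewrite !mul0r !add0r sE.
Qed.

(** The indicators put the q-th element in the pair {2q, 2q+1}. Adding the two columns of a pair
    adds the weights 1 and 2, hence the factor 3. *)
Lemma sum_transversal_minors n :
  \sum_(S : {set 'I_(2 * n)} | #|S| == n)
     (\prod_(q < n) ((nth 0%N (elements S) q)./2 == q)%:R) * minor n (orbital n) S
  = 3 ^+ n * 5 ^+ 'C(n, 2).
Proof.
rewrite -(det_sum_sets _ (tau := fun (q : 'I_n) x => (x./2 == q)%:R)); last first.
  move=> q r x y qr; rewrite !pnatr_eq0 !eqb0 !negbK => /eqP xq /eqP yr.
  by lia.
have -> : \matrix_(p < n, q < n) \sum_(x < 2 * n) (x./2 == q)%:R * orbital n p x =
   \matrix_(p < n, q < n) (orbital n p (false + q.*2)%N + orbital n p (true + q.*2)%N).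
  apply/matrixP=> p q; rewrite !mxE.
  rewrite mul2n (sum_pairs (fun x => (x./2 == q)%:R * orbital n p x)).
  rewrite (bigD1 q) //= big1 ?addr0.
    by rewrite doubleK uphalf_double eqxx !mul1r.
  by move=> l /negPf lq; rewrite doubleK uphalf_double val_eqE lq !mul0r addr0.
rewrite (det_binomial_expansion (c := fun p => 3 * 5 ^+ p)
  (f := fun p q => orbital n p (false + q.*2)%N + orbital n p (true + q.*2)%N)).
  rewrite big_split /= prodr_const card_ord prodrXr; congr (_ * 5 ^+ _).
  by rewrite -bin2_sum big_mkord.
case: n => // n p pn.
have expn b := @orbital_expansion n p b pn.
apply: eq_binomial_expansion (binomial_expansionD (expn false) (expn true)) => //.
by rewrite /plus_weight addn0 addn1 /=; case: odd => /=; ring.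
Qed.

(** * Matrices as paths of column sets *)

Lemma halved_asmP n (A : 'M[seq_sub asm_values]_(n, 2 * n)) : let M := int_mx A in
  reflect ((forall j x, 0 <= \sum_(l < n | (l < x)%N) M l j <= 1) /\
     (forall i, (forall x, 0 <= \sum_(r < 2 * n | (r < x)%N) M i r <= 1) /\ \sum_j M i j = 1))
  (halved_asm M).
Proof.
move=> M; have Mv i j : M i j \in asm_values by rewrite mxE ssvalP.
have rowv i : all (mem asm_values) (row_seq M i) by apply/allP=> _ /mapP[j _ ->]; apply: Mv.
have colv j : all (mem asm_values) (col_seq M j) by apply/allP=> _ /mapP[i _ ->]; apply: Mv.
have rowE i : \sum_j M i j = \sum_(y <- row_seq M i) y by rewrite big_map big_enum.
apply: (iffP and5P) => [[_ /forallP altr /forallP altc /forallP sumr /forallP hd]|[col row]].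
  split=> [j x|i].
    rewrite -sum_take_ord; move: x; apply/(alternating_head1 (colv j)).
    by rewrite altc hd.
  have := elimT (alternating_sum1 (rowv i)); rewrite altr -rowE sumr => /(_ isT)[H ->].
  by split=> // x; rewrite -sum_take_ord.
have colP j : alternating (col_seq M j) && (head 1 (nonzeros (col_seq M j)) == 1).
  by apply/(alternating_head1 (colv j)) => x; rewrite sum_take_ord.
have rowP i : alternating (row_seq M i) && (\sum_(y <- row_seq M i) y == 1).
  apply/(alternating_sum1 (rowv i)); have [H Hs] := row i; rewrite -rowE; split=> // x.
  by rewrite sum_take_ord.
split; apply/forallP.
- by move=> i; apply/forallP=> j.
- by move=> i; have /andP[] := rowP i.
- by move=> j; have /andP[] := colP j.
- by move=> i; have /andP[] := rowP i; rewrite rowE.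
- by move=> j; have /andP[] := colP j.
Qed.

Lemma below_sum N (S : {set 'I_N}) x :
  (below S x)%:R = \sum_(r < N | (r < x)%N) (r \in S)%:R :> int.
Proof.
rewrite /below -sum1_card natr_sum big_mkcond [RHS]big_mkcond.
by apply: eq_bigr => r _; rewrite inE; case: (r \in S); case: (r < x)%N.
Qed.

Definition asm_zero : seq_sub asm_values := SeqSub (mem_head 0 [:: 1; -1]).

Definition asm_diff (s s' : bool) : seq_sub asm_values :=
  insubd asm_zero (s'%:R - s%:R).

Lemma val_asm_diff s s' : val (asm_diff s s') = s'%:R - s%:R.
Proof. by rewrite /asm_diff insubdK //; case: s; case: s'. Qed.

Section States.
Variable n : nat.
Implicit Types P : n.-tuple {set 'I_(2 * n)}.

Definition state P (i : nat) : {set 'I_(2 * n)} := nth set0 (set0 :: P) i.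

Definition states_mx P : 'M[seq_sub asm_values]_(n, 2 * n) :=
  \matrix_(i, j) asm_diff (j \in state P i) (j \in state P i.+1).

Definition mx_states (A : 'M[seq_sub asm_values]_(n, 2 * n)) : n.-tuple {set 'I_(2 * n)} :=
  [tuple [set j | \sum_(l < n | (l < i.+1)%N) int_mx A l j == 1] | i < n].

Lemma sum_ord_lt_recr (F : nat -> int) x : (x < n)%N ->
  \sum_(l < n | (l < x.+1)%N) F l = \sum_(l < n | (l < x)%N) F l + F x.
Proof.
move=> xn; rewrite -!(big_ord_widen n F) ?(ltnW xn) //.
by rewrite big_ord_recr.
Qed.

Lemma states_mx_partial_sum P j x : (x <= n)%N ->
  \sum_(l < n | (l < x)%N) int_mx (states_mx P) l j = (j \in state P x)%:R.
Proof.
move=> xn; under eq_bigr => l _ do rewrite !mxE val_asm_diff.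
elim: x xn => [|x IH] xn; first by rewrite big_pred0 // inE.
pose F l : int := (j \in state P l.+1)%:R - (j \in state P l)%:R.
by rewrite (sum_ord_lt_recr F) // (IH (ltnW xn)) /F addrC subrK.
Qed.

Lemma states_mxK : cancel states_mx mx_states.
Proof.
move=> P; apply: eq_from_tnth => i; rewrite tnth_mktuple; apply/setP=> j.
rewrite inE states_mx_partial_sum // /state /= (tnth_nth set0).
by case: (j \in _).
Qed.

Lemma mx_statesK A : halved_asm (int_mx A) -> states_mx (mx_states A) = A.
Proof.
case/halved_asmP=> col _; pose c j x := \sum_(l < n | (l < x)%N) int_mx A l j.
have stE j x : (x <= n)%N -> (j \in state (mx_states A) x)%:R = c j x.
  case: x => [|x] xn; first by rewrite /state inE /c big_pred0.
  have -> : state (mx_states A) x.+1 = tnth (mx_states A) (Ordinal xn).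
    by rewrite (tnth_nth set0).
  rewrite tnth_mktuple inE.
  by have := col j x.+1; rewrite -/(c j x.+1); move: (c j x.+1) => z zP; case: eqP; lia.
apply/matrixP=> i j; apply/val_inj; rewrite mxE val_asm_diff.
rewrite (stE j i.+1 (ltn_ord i)) (stE j i (ltnW (ltn_ord i))) /c.
(* Extends the column to all natural indices, as [sum_ord_lt_recr] requires. *)
pose F l := if insub l is Some l' then int_mx A l' j else 0.
have FE (l : 'I_n) : int_mx A l j = F l by rewrite /F valK.
under eq_bigr => l _ do rewrite FE.
under [X in _ - X]eq_bigr => l _ do rewrite FE.
by rewrite sum_ord_lt_recr // addrC addKr -FE mxE.
Qed.

(** The column conditions hold for every chain, since column partial sums are membership indicators;
    the constraints come from the rows. *)
Lemma halved_states_mx P : halved_asm (int_mx (states_mx P)) =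
  [forall i : 'I_n, interlaced (state P i) (state P i.+1) &&
     (#|state P i.+1| == #|state P i|.+1)].
Proof.
have rowE (i : 'I_n) x : \sum_(r < 2 * n | (r < x)%N) int_mx (states_mx P) i r
    = (below (state P i.+1) x)%:R - (below (state P i) x)%:R.
  rewrite !below_sum -sumrB; apply: eq_bigr => r _.
  by rewrite !mxE val_asm_diff.
have rowT (i : 'I_n) : \sum_r int_mx (states_mx P) i r
    = #|state P i.+1|%:R - #|state P i|%:R.
  rewrite -!(below_full _ (leqnn (2 * n))) -rowE; apply: eq_bigl => r.
  by rewrite ltn_ord.
apply/halved_asmP/forallP => [[_ row] i|H].
  have [ineq tot] := row i; apply/andP; split.
    by apply/forallP=> x; have := ineq x; rewrite rowE; lia.
  by move: tot; rewrite rowT; lia.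
split=> [j x|i].
  have -> : \sum_(l < n | (l < x)%N) int_mx (states_mx P) l j
      = \sum_(l < n | (l < minn x n)%N) int_mx (states_mx P) l j.
    by apply: eq_bigl => l; rewrite leq_min ltn_ord andbT.
  by rewrite states_mx_partial_sum ?geq_minr //; case: (j \in _).
have /andP[/forallP inter /eqP cS] := H i; rewrite rowT cS; split; last by lia.
move=> x; rewrite rowE; case: (ltnP x (2 * n).+1) => [xN|/ltnW xN].
  by have /= := inter (Ordinal xN); lia.
by rewrite !below_full // cS; lia.
Qed.

(** The bottom height at 2i is n + 2i - 2 [below S (2 * i)], so the condition says that exactly i
    elements lie below 2i for every i. *)
Lemma boundary_states_mx P : #|state P n| = n ->
  height_boundary (int_mx (states_mx P)) =
  [forall q : 'I_n, (nth 0%N (elements (state P n)) q)./2 == q].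
Proof.
move=> cS; set S := state P n in cS *.
have hE (i : 'I_n.+1) : (height (int_mx (states_mx P)) ord_max (inord (2 * i)) == n%:Z)
    = (below S (2 * i) == i).
  rewrite mxE inordK; last by have := ltn_ord i; lia.
  rewrite exchange_big /=.
  have -> : \sum_(r < 2 * n | (r < 2 * i)%N) \sum_(l < n | (l < n)%N) int_mx (states_mx P) l r
      = (below S (2 * i))%:R.
    by rewrite below_sum; apply: eq_bigr => r _; rewrite states_mx_partial_sum.
  by lia.
apply/forallP/forallP => H q.
  have {}H i : (i <= n)%N -> below S (2 * i) = i.
    by rewrite -ltnS => iN; apply/eqP; have := H (Ordinal iN); rewrite hE.
  have qS : (q < #|S|)%N by rewrite cS.
  have := nth_elements_lt (2 * q) qS; have := nth_elements_lt (2 * q.+1) qS.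
  by rewrite (H q.+1) // (H q (ltnW (ltn_ord q))); lia.
rewrite hE eqn_leq; apply/andP; split.
  have := ltn_ord q; rewrite ltnS leq_eqVlt => /predU1P[qn|qn].
    by rewrite qn -[X in (_ <= X)%N]cS below_le_card.
  rewrite leqNgt -nth_elements_lt ?cS //.
  by have /eqP := H (Ordinal qn); rewrite /=; lia.
case: q => -[|q] qn //=; rewrite -nth_elements_lt ?cS //.
by have /eqP := H (Ordinal (qn : (q < n)%N)); rewrite /=; lia.
Qed.

Lemma states_mx_weight P :
  (2 ^ (Nminus_even (int_mx (states_mx P)) + Nplus_odd (int_mx (states_mx P))))%:R
  = \prod_(i < n) \prod_(j < 2 * n)
      cell_weight (plus_weight i) (j \in state P i) (j \in state P i.+1) j.
Proof.
rewrite natrX exprD /Nminus_even /Nplus_odd -!prodr_const.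
rewrite pair_bigA /= big_mkcond [X in _ * X]big_mkcond -big_split /=.
apply: eq_bigr => -[i j] _; rewrite !inE !mxE val_asm_diff /cell_weight /plus_weight /=.
by case: odd; case: (j \in state P i); case: (j \in state P i.+1).
Qed.

End States.

(** * Summation over paths and conclusion *)

Lemma sum_tuple_cons (R : nmodType) (T : finType) r (F : seq T -> R) :
  \sum_(t : r.+1.-tuple T) F t = \sum_y \sum_(u : r.-tuple T) F (y :: u).
Proof.
rewrite pair_bigA /= (reindex (fun p : T * r.-tuple T => cons_tuple p.1 p.2)) //.
exists (fun t => (thead t, behead_tuple t)) => [[y u] _|t _] /=.
  by rewrite theadE; congr pair; apply/val_inj.
by apply/val_inj; rewrite /= [t]tuple_eta.
Qed.

(** The start [i] is arbitrary because the induction absorbs the first step of the path into [V]. *)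
Lemma sum_paths (R : comNzRingType) (T : finType) (x0 : T) (K : nat -> T -> T -> R)
    (V : nat -> T -> R) (phi : T -> R) :
  (forall i y, V i.+1 y = \sum_x V i x * K i x y) -> forall r i,
  \sum_x V i x * \sum_(t : r.-tuple T)
    (\prod_(j < r) K (i + j)%N (nth x0 (x :: t) j) (nth x0 (x :: t) j.+1))
      * phi (nth x0 (x :: t) r)
  = \sum_y V (i + r)%N y * phi y.
Proof.
move=> VS; elim=> [|r IH] i.
  apply: eq_bigr => x _; rewrite addn0; congr (_ * _).
  rewrite (big_pred1 [tuple]) ?big_ord0 ?mul1r // => t /=.
  by rewrite [t]tuple0; apply/esym/eqP.
rewrite addnS -addSn -IH.
under [RHS]eq_bigr => y _ do rewrite VS mulr_suml.
rewrite exchange_big /=; apply: eq_bigr => x _.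
rewrite (sum_tuple_cons r (fun t : seq T => (\prod_(j < r.+1) K (i + j)%N (nth x0 (x :: t) j)
  (nth x0 (x :: t) j.+1)) * phi (nth x0 (x :: t) r.+1))) mulr_sumr.
apply: eq_bigr => y _; rewrite -mulrA; congr (_ * _); rewrite mulr_sumr.
apply: eq_bigr => u _; rewrite big_ord_recl /= addn0 -!mulrA; congr (_ * (_ * _)).
by apply: eq_bigr => j _; rewrite /= /bump add1n addnS addSn.
Qed.

Theorem theorem2 (n : nat) (hn : (1 <= n)%N) :
  (\sum_(A in Hset n) 2 ^ (Nminus_even (int_mx A) + Nplus_odd (int_mx A))
   = 3 ^ n * 5 ^ 'C(n, 2))%N.
Proof.
pose K i (S S' : {set 'I_(2 * n)}) :=
  (#|S'| == #|S|.+1)%:R * row_weight (plus_weight i) S S'.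
pose V i (S : {set 'I_(2 * n)}) := (#|S| == i)%:R * minor i (orbital i) S.
pose phi (S : {set 'I_(2 * n)}) : rat :=
  \prod_(q < n) ((nth 0%N (elements S) q)./2 == q)%:R.
have VS i S' : V i.+1 S' = \sum_S V i S * K i S S'.
  rewrite /V /K; case: eqP => [cS'|cS'].
    rewrite mul1r -(minor_transfer (plus_weight_neq0 i) _ cS') big_mkcond /=.
    apply: eq_bigr => S _; case: eqP => [cS|_]; last by rewrite !mul0r.
    by rewrite cS' cS eqxx !mul1r.
  rewrite mul0r big1 // => S _; case: (#|S| =P i) => [cS|_]; last by rewrite !mul0r.
  by rewrite cS; case: eqP => // _; rewrite mul0r mulr0.
(* The empty determinant is 1, so all paths start at [set0]. *)
have V0 S : V 0%N S = (S == set0)%:R.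
  by rewrite /V /minor det_mx00 mulr1 cards_eq0.
have := sum_paths set0 phi VS n 0.
rewrite add0n (bigD1 set0) //= V0 eqxx mul1r [X in _ + X]big1 ?addr0; last first.
  by move=> S /negPf S0; rewrite V0 S0 mul0r.
have -> : \sum_S V n S * phi S = (3 ^ n * 5 ^ 'C(n, 2))%N%:R.
  rewrite natrM !natrX -sum_transversal_minors [RHS]big_mkcond /=.
  apply: eq_bigr => S _; rewrite /V; case: eqP => _; last by rewrite !mul0r.
  by rewrite mul1r mulrC.
(* The weight 2 / w forces rational computation; the identity in [nat] follows by injectivity of the
   cast. *)
move=> pathsE; apply/eqP; rewrite -(eqr_nat rat) -pathsE natr_sum; apply/eqP.
rewrite (reindex_onto (@states_mx n) (@mx_states n)) /=; last first.
  by move=> A; rewrite inE => /andP[/mx_statesK].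
rewrite big_mkcond; apply: eq_bigr => P _; rewrite states_mxK eqxx andbT inE.
rewrite halved_states_mx states_mx_weight.
have prod_bool (b : 'I_n -> bool) : \prod_(i < n) (b i)%:R = [forall i, b i]%:R :> rat.
  case: (boolP [forall i, b i]) => [/forallP H|/forallPn[i /negPf bi]].
    by apply: big1 => i _; rewrite H.
  by rewrite (bigD1 i) //= bi mul0r.
have -> : \prod_(i < n) K (0 + i)%N (nth set0 (set0 :: P) i) (nth set0 (set0 :: P) i.+1) =
    [forall i : 'I_n, interlaced (state P i) (state P i.+1) &&
      (#|state P i.+1| == #|state P i|.+1)]%:R *
    \prod_(i < n) \prod_(j < 2 * n)
      cell_weight (plus_weight i) (j \in state P i) (j \in state P i.+1) j.
  rewrite -prod_bool -big_split /=; apply: eq_bigr => i _.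
  by rewrite /K /row_weight add0n mulrA -natrM mulnb andbC.
case: forallP => [H|_]; last by rewrite !mul0r.
have cS i : (i <= n)%N -> #|state P i| = i.
  elim: i => [|i IH] iN; first by rewrite /state cards0.
  by have /andP[_ /eqP ->] := H (Ordinal iN); rewrite IH // ltnW.
rewrite mul1r boundary_states_mx ?cS //= -/(state P n) /phi prod_bool.
by case: [forall _, _]; rewrite ?mulr1 ?mulr0.
Qed.
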